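(* Let $C$ be an orientation of a cycle of even length. If $\alpha_C(2)$ and $\gamma_C$ are both non-zero and have different signs, then $C$ is not quasirandom-forcing.
   Context: A kernel is a bounded measurable function $[0,1]^2\to\mathbb{R}$. A tournamenton is a non-negative kernel $W$ with $W(x,y)+W(y,x)=1$ for all $(x,y)$. For an oriented graph $H$ and a kernel $U$, $t(H,U)=\int_{[0,1]^{V(H)}}\prod_{vw\in E(H)}U(x_v,x_w)\,\mathrm{d}x_{V(H)}$; $\|H\|$ is the number of edges of $H$. $H$ is quasirandom-forcing if every tournamenton $W$ with $t(H,W)=2^{-\|H\|}$ equals $1/2$ almost everywhere. $Q_2$ is the oriented path with two edges both oriented away from the middle vertex. For an oriented cycle $C$ and $F\subseteq E(C)$, $C\langle F\rangle$ is the spanning subgraph with edge set $F$. $\alpha_C(2)$ is the number of sets $F\subseteq E(C)$ such that $C\langle F\rangle$ can be obtained from $Q_2$ by reversing an even number of edges and adding isolated vertices, minus the number of such $F$ where $C\langle F\rangle$ is obtained from $Q_2$ by reversing an odd number of edges and adding isolated vertices. For $n\ge 2$, $D_{2n}$ is the orientation of the cycle with $2n$ vertices obtained by choosing two opposite vertices and orienting all edges in the direction from one of them to the other. For an oriented cycle $C$ of even length $\ell$, $\gamma_C=+1$ if $C$ can be obtained from $D_\ell$ by reversing an even number of edges, and $\gamma_C=-1$ otherwise. *)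

(* Defs.v *)
From HB Require Import structures.
From mathcomp Require Import all_boot all_order all_algebra.
From mathcomp Require Import all_classical all_reals all_analysis.

Set Implicit Arguments.
Unset Strict Implicit.
Unset Printing Implicit Defensive.

Import Order.TTheory GRing.Theory Num.Theory.

Local Open Scope ring_scope.

(* An oriented graph with vertex set V is given by its set of arcs
   A : {set V * V}, where (v, w) \in A is the edge directed from v to w.
   The spanning subgraph C<F> is the set F itself, as F \subset C. *)

Definition cycle_orientation (V : finType) (C : {set V * V}) : Prop :=
  exists (l : nat) (f : 'I_l -> V) (o : 'I_l -> bool),
    [/\ (2 < l)%N, bijective f &
      C = [set (if o i then (f i, f (ordS i)) else (f (ordS i), f i))
             | i : 'I_l]].

Definition reverse_arcs (V : finType) (A S : {set V * V}) : {set V * V} :=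
  (A :\: S) :|: [set (e.2, e.1) | e in S].

(* B is, up to isomorphism, obtained from A by reversing a set S of edges with
   odd #|S| = p and adding isolated vertices: those of W outside the image
   of f. None are added when #|V| = #|W|, as f is then a bijection. *)
Definition obtained (p : bool) (V W : finType)
    (A : {set V * V}) (B : {set W * W}) : bool :=
  [exists S : {set V * V}, exists f : {ffun V -> W},
    [&& S \subset A, odd #|S| == p, injectiveb f &
        B == [set (f e.1, f e.2) | e in reverse_arcs A S]]].

(* The middle vertex of the path is 1. *)
Definition Q2 : {set 'I_3 * 'I_3} :=
  [set e : 'I_3 * 'I_3 | (e.1 == 1%N :> nat) && (e.2 != 1%N :> nat)].

Definition alpha2 (V : finType) (C : {set V * V}) : int :=
  #|[set F : {set V * V} | (F \subset C) && obtained false Q2 F]|%:Z -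
  #|[set F : {set V * V} | (F \subset C) && obtained true Q2 F]|%:Z.

(* D_{2n}, directed from vertex 0 to vertex n; ordS is the cyclic successor. *)
Definition Dcycle (n : nat) : {set 'I_n.*2 * 'I_n.*2} :=
  [set (if (i < n)%N then (i, ordS i) else (ordS i, i)) | i : 'I_n.*2].

(* A cycle has length #|C|, which is also its number of vertices. *)
Definition gamma (V : finType) (C : {set V * V}) : int :=
  if obtained false (Dcycle #|C|./2) C then 1 else -1.

Local Open Scope classical_set_scope.

Section Densities.
Context {R : realType}.
Local Notation mR := (measurableTypeR R).

Definition cons_pair (n : nat) (z : mR * n.-tuple mR) : n.+1.-tuple mR :=
  [tuple of z.1 :: z.2].

Lemma measurable_cons_pair (n : nat) : measurable_fun setT (@cons_pair n).
Proof. exact: measurable_cons. Qed.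

HB.instance Definition _ (n : nat) :=
  isMeasurableFun.Build _ _ _ _ (@cons_pair n) (@measurable_cons_pair n).

(* Lebesgue measure on [0,1], as a probability measure on R. *)
Definition unif01 : probability mR R := uniform_prob (@ltr01 R).

(* The n-fold product of unif01, i.e. Lebesgue measure on [0,1]^n. *)
Fixpoint unif_cube (n : nat) : probability (n.-tuple mR) R :=
  match n with
  | 0%N => \d_([tuple] : 0.-tuple mR)
  | m.+1 => distribution (unif01 \x unif_cube m)%E (@cons_pair m)
  end.

Definition cube (n : nat) : set (n.-tuple mR) :=
  [set x | forall i, tnth x i \in `[0, 1]].

Definition square : set (mR * mR) := `[0, 1] `*` `[0, 1].

(* Only the values of U on the square are ever used. *)
Definition bounded_kernel (U : R -> R -> R) : Prop :=
  measurable_fun square (fun z => U z.1 z.2) /\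
  exists M : R, forall z, square z -> `|U z.1 z.2| <= M.

Definition tournamenton (W : R -> R -> R) : Prop :=
  [/\ bounded_kernel W,
      forall z, square z -> 0 <= W z.1 z.2 &
      forall z, square z -> W z.1 z.2 + W z.2 z.1 = 1].

(* The coordinate x_v is indexed by the rank of v in the enumeration of V. *)
Definition hom_density (V : finType) (H : {set V * V}) (U : R -> R -> R) : R :=
  \int[unif_cube #|V|]_(x in @cube #|V|)
    \prod_(e in H) U (tnth x (enum_rank e.1)) (tnth x (enum_rank e.2)).

End Densities.

Definition quasirandom_forcing (R : realType) (V : finType)
    (H : {set V * V}) : Prop :=
  forall W : R -> R -> R, tournamenton W -> hom_density H W = 2 ^- #|H| ->
    {ae (unif01 \x unif01)%E, forall z, square z -> W z.1 z.2 = 2^-1}.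

(* Main.v *)
(* Partition [0,1] into four quarters, indexed by two bits, with signs u and v.
   For the skew kernels U(x,y) = u(y) - u(x) and U'(x,y) = v(x) v(y) U(x,y), the
   tournamenton W = 1/2 + a U + b U' satisfies
     t(C,W) = t(C, 1/2 + a U) + b^l t(C,U'),
   since flipping v at a vertex where exactly one incident edge carries U' kills
   every mixed term.  As a -> 0, t(C, 1/2 + a U) - 2^-l is a positive multiple of
   alpha_C(2) a^2 up to O(a^3): spanning subgraphs with one edge or with two
   disjoint edges contribute 0, and copies of Q_2 contribute +1 or -1.  Finally
   t(C,U') has the sign of gamma_C.  If the two signs differ, then for small
   a > 0 some b >= 0 makes the two contributions cancel, while W is not 1/2. *)
Require Import Defs.
From mathcomp Require Import all_boot all_order all_algebra.
From mathcomp Require Import all_classical all_reals all_analysis.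
From mathcomp Require Import measurable_realfun ring lra.

Set Implicit Arguments.
Unset Strict Implicit.
Unset Printing Implicit Defensive.

Import Order.TTheory GRing.Theory Num.Theory.

Local Open Scope ring_scope.

(** * Colour sums *)

Section FiniteSums.
Import boot.fintype boot.finset.
Variable R : realFieldType.

(** An injective self-map of a finite type permutes it, so reindexing along [h] turns the sum into
    its own opposite. The vanishing colour sums below all rest on such a symmetry. *)
Lemma sum_antisym (X : finType) (h : X -> X) (G : X -> R) :
  injective h -> (forall x, G (h x) = - G x) -> \sum_x G x = 0.
Proof.
move=> hI hG; set s := \sum_x G x.
suff : s = - s by move=> ?; lra.
by rewrite {1}/s (reindex_inj hI) /= -sumrN; apply: eq_bigr.
Qed.

Lemma prodD_subset (T : finType) (A : {set T}) (F G : T -> R) :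
  \prod_(e in A) (F e + G e) =
  \sum_(J : {set T} | J \subset A)
    (\prod_(e in J) F e) * \prod_(e in A :\: J) G e.
Proof.
rewrite big_mkcond /=.
(* Outside [A] the factor is written as 0 + 1, so any [J] not contained in [A] contributes 0. *)
rewrite (eq_bigr (fun e =>
  (if e \in A then F e else 0) + (if e \in A then G e else 1))); last first.
  by move=> e _; case: ifP; rewrite ?add0r.
rewrite bigA_distr (bigID (fun J : {set T} => J \subset A)) /=.
rewrite [X in _ + X]big1 ?addr0; last first.
  move=> J /subsetPn[e eJ eA].
  by rewrite (bigD1 e) //= eJ (negbTE eA) mul0r.
apply: eq_bigr => J /subsetP JA.
rewrite [in RHS]big_mkcond [X in _ = _ * X]big_mkcond -big_split /=.
apply: eq_bigr => e _; rewrite !inE.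
case: ifP => [eJ|_]; first by rewrite (JA _ eJ) mulr1.
by rewrite mul1r.
Qed.

End FiniteSums.

Section Colourings.
Import boot.fintype boot.finset.
Variable R : realFieldType.
Local Notation K := (bool * bool)%type.
Implicit Types (V W : finType).

Definition usgn (x : K) : R := (-1) ^+ x.1.
Definition vsgn (x : K) : R := (-1) ^+ x.2.
Definition udiff (x y : K) : R := usgn y - usgn x.
Definition vudiff (x y : K) : R := vsgn x * vsgn y * udiff x y.
Definition col_prod V (M : K -> K -> R) (H : {set V * V}) (phi : {ffun V -> K})
  : R := \prod_(e in H) M (phi e.1) (phi e.2).
(** Up to the factor 4^-#|V|, this is the density of [H] in the step kernel with values [M] on four
    cells of measure 1/4. *)
Definition col_sum V (M : K -> K -> R) (H : {set V * V}) : R :=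
  \sum_phi col_prod M H phi.

Lemma usgn_sq x : usgn x * usgn x = 1.
Proof. by rewrite /usgn -expr2 sqrr_sign. Qed.
Lemma vsgn_sq x : vsgn x * vsgn x = 1.
Proof. by rewrite /vsgn -expr2 sqrr_sign. Qed.
Lemma udiffN x y : udiff y x = - udiff x y.
Proof. by rewrite /udiff opprB. Qed.
Lemma vudiffN x y : vudiff y x = - vudiff x y.
Proof. by rewrite /vudiff udiffN mulrN [vsgn y * _]mulrC. Qed.

Definition recolour V (g : K -> K) (x : V) (phi : {ffun V -> K}) :
  {ffun V -> K} := [ffun z => if z == x then g (phi z) else phi z].

Lemma recolour_inj V g (x : V) : injective g -> injective (recolour g x).
Proof.
move=> gI p q /ffunP e; apply/ffunP => z; move: (e z); rewrite !ffunE.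
by case: eqP => // _ /gI.
Qed.

Definition flip1 (k : K) : K := (~~ k.1, k.2).
Definition flip2 (k : K) : K := (k.1, ~~ k.2).

Lemma flip1_inj : injective flip1.
Proof. by move=> [[] []] [[] []]. Qed.
Lemma flip2_inj : injective flip2.
Proof. by move=> [[] []] [[] []]. Qed.

Lemma usgn_flip1 k : usgn (flip1 k) = - usgn k.
Proof. by rewrite /usgn; case: k => [[] b] /=; rewrite ?opprK. Qed.
Lemma vsgn_flip2 k : vsgn (flip2 k) = - vsgn k.
Proof. by rewrite /vsgn; case: k => [b []] /=; rewrite ?opprK. Qed.

Lemma sum_usgn2 V (x y : V) : x != y ->
  \sum_(phi : {ffun V -> K}) usgn (phi x) * usgn (phi y) = 0.
Proof.
move=> xy; apply: (@sum_antisym _ _ (recolour flip1 x)).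
  exact/recolour_inj/flip1_inj.
move=> phi; rewrite !ffunE eqxx eq_sym (negbTE xy) usgn_flip1.
by rewrite mulNr.
Qed.

(* u(c)^2 = 1 is the only term of the expanded product with non-zero mean. *)
Lemma sum_cherry V (c p q : V) : c != p -> c != q -> p != q ->
  \sum_(phi : {ffun V -> K}) udiff (phi c) (phi p) * udiff (phi c) (phi q) =
  #|{ffun V -> K}|%:R.
Proof.
move=> cp cq pq.
rewrite (eq_bigr (fun phi : {ffun V -> K} =>
   usgn (phi p) * usgn (phi q) - usgn (phi c) * usgn (phi p)
   - usgn (phi c) * usgn (phi q) + 1)); last first.
  move=> phi _;  rewrite -(usgn_sq (phi c)) /udiff; ring.
rewrite !big_split /= !sumrN !sum_usgn2 // !subr0 add0r.
by rewrite sumr_const.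
Qed.

(** Excludes loops as well as opposite pairs, so that in [reverse_arcs] the reversed arcs never
    collide with the kept ones. *)
Definition oriented V (A : {set V * V}) :=
  forall e, e \in A -> (e.2, e.1) \notin A.

(** For a skew [M], each reversed arc contributes a factor -1, hence only the parity of the number
    of reversals survives. *)
Lemma obtained_col_prod V W p (A : {set V * V}) (B : {set W * W}) M :
  (forall x y, M y x = - M x y) -> oriented A -> obtained p A B ->
  exists2 f : V -> W, injective f &
  forall phi, col_prod M B phi =
     (-1) ^+ p * \prod_(e in A) M (phi (f e.1)) (phi (f e.2)).
Proof.
move=> MN oA /existsP[S /existsP[f /and4P[/subsetP SA /eqP Sp /injectiveP fI /eqP ->]]].
exists f => // phi; rewrite /col_prod.
have swI : injective (fun e : V * V => (e.2, e.1)) by move=> [? ?] [? ?] [-> ->].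
rewrite big_imset /=; last by move=> [? ?] [? ?] _ _ [/fI -> /fI ->].
rewrite (eq_bigl [in [predU (A :\: S) & [set (e.2, e.1) | e in S]]]); last first.
  by move=> e; rewrite !inE.
rewrite bigU /=; last first.
  rewrite disjoint_subset; apply/subsetP => e; rewrite !inE => /andP[_ eA].
  apply/negP => /imsetP[e' e'S ee']; move: (oA _ (SA _ e'S)); by rewrite -ee' eA.
rewrite big_imset /=; last by move=> ? ? _ _ /swI.
rewrite [in RHS](big_setID S) /= (_ : A :&: S = S); last first.
  by apply/setIidPr/subsetP.
under [X in _ * X = _]eq_bigr => e _ do rewrite MN.
rewrite prodrN -(signr_odd _ #|S|) Sp mulrCA.
by congr (_ * _); rewrite mulrC.
Qed.

Lemma Q2E : Q2 = [set (1 : 'I_3, 0 : 'I_3); (1 : 'I_3, 2 : 'I_3)].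
Proof.
apply/setP => -[[[|[|[|//]]] i] [[|[|[|//]]] j]]; by rewrite !inE.
Qed.

Lemma Q2_oriented : oriented Q2.
Proof. by move=> e; rewrite !inE => /andP[/eqP -> /=]; case: (_ == _). Qed.

Lemma obtained_Q2_sum W p (F : {set W * W}) : obtained p Q2 F ->
  col_sum udiff F = (-1) ^+ p * #|{ffun W -> K}|%:R.
Proof.
case/(obtained_col_prod udiffN Q2_oriented) => f fI fE.
rewrite /col_sum; under eq_bigr => phi _ do rewrite fE Q2E.
rewrite -mulr_sumr; congr (_ * _).
under eq_bigr => phi _ do
  rewrite big_setU1 ?inE -?val_eqE //= big_set1 /=.
by apply: sum_cherry; rewrite (inj_eq fI).
Qed.

Lemma obtained_Q2_card W p (F : {set W * W}) : obtained p Q2 F -> #|F| = 2.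
Proof.
case/existsP=> S /existsP[f /and4P[SA _ /injectiveP fI /eqP ->]].
rewrite card_imset; last by move=> [? ?] [? ?] [/fI -> /fI ->].
have Q2c : #|Q2| = 2 by rewrite Q2E cards2.
rewrite /reverse_arcs cardsU card_imset; last by move=> [? ?] [? ?] [-> ->].
have -> : (Q2 :\: S) :&: [set (e.2, e.1) | e in S] = set0.
  apply/setP => e; rewrite [RHS]inE; apply/negP => /setIP[/setDP[eA _]].
  case/imsetP => e' e'S ee'; move: (Q2_oriented (subsetP SA _ e'S)).
  by rewrite -ee' eA.
rewrite cards0 subn0 cardsD Q2c (setIidPr SA) subnK //.
by rewrite -Q2c subset_leq_card.
Qed.

Lemma obtained_Q2_cherry W (c p q : W) (o1 o2 : bool) :
  c != p -> c != q -> p != q ->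
  exists b, obtained b Q2
    [set (if o1 then (c, p) else (p, c)); (if o2 then (c, q) else (q, c))].
Proof.
move=> cp cq pq.
(* The middle vertex 1 goes to [c], and [S] collects the arcs that [o1] and [o2] direct towards
   [c]. *)
pose f := [ffun i : 'I_3 => if i == 1 then c else if i == 0 then p else q].
pose S := [set e in Q2 | if e.2 == 0 then ~~ o1 else ~~ o2].
exists (odd #|S|); apply/existsP; exists S; apply/existsP; exists f.
apply/and4P; split=> //; first by apply/subsetP => e; rewrite inE => /andP[].
  apply/injectiveP => i j; rewrite !ffunE.
  case: i j => [[|[|[|//]]] i] [[|[|[|//]]] j] /=; move=> e; apply: val_inj => //=;
  move: e cp cq pq; rewrite -?val_eqE /= => ->; by rewrite ?eqxx.
have -> : reverse_arcs Q2 S =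
   [set (if o1 then (1, 0) else (0, 1)); (if o2 then (1, 2) else (2, 1))].
  have SE : forall e, ((e.2, e.1) \in S) = (e \in [set (e.2, e.1) | e in S]).
    move=> [i j]; apply/idP/imsetP => [h|[[i' j'] h [-> ->]]] //=.
    by exists (j, i).
  apply/setP => -[i j]; rewrite 2!inE -SE !inE.
  case: i j => [[|[|[|//]]] i] [[|[|[|//]]] j];
  by case: (o1); case: (o2); rewrite -!val_eqE.
rewrite imsetU1 imset_set1; apply/eqP.
by case: (o1); case: (o2); rewrite !ffunE.
Qed.

End Colourings.

(** * Orientations of a cycle *)

Section Cycles.
Import boot.fintype boot.finset fingroup.perm.
Local Notation K := (bool * bool)%type.

Lemma ordS_iter2_neq l (i : 'I_l) : (2 < l)%N -> ordS (ordS i) != i.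
Proof.
move=> l2; apply/negP => /eqP /(congr1 val) /= /eqP.
rewrite -addn1 modnDml addn1 -[X in _ == X](modn_small (ltn_ord i)).
by rewrite -addn2 -[X in _ == X %[mod _]]addn0 eqn_modDl mod0n modn_small.
Qed.

Lemma ordS_neq l (i : 'I_l) : (2 < l)%N -> ordS i != i.
Proof.
move=> l2; apply/negP => /eqP e; have := ordS_iter2_neq i l2.
by rewrite !e eqxx.
Qed.

(** The cyclic successor has a single orbit: [j] is reached from [i] after j + (l - i) steps. *)
Lemma ordS_closed l (P : pred 'I_l) : (forall i, P i -> P (ordS i)) ->
  forall i j, P i -> P j.
Proof.
case: l P => [P _ []//|l P PS i j Pi].
have step k : P (inord ((i + k) %% l.+1)).
  elim: k => [|k IH]; first by rewrite addn0 modn_small // inord_val.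
  have := PS _ IH; congr (P _); apply/val_inj.
  by rewrite /= !inordK ?ltn_mod // -addn1 modnDml addn1 addnS.
have := step (j + (l.+1 - i))%N; congr (P _); apply/val_inj.
rewrite /= inordK ?ltn_mod // addnCA subnKC; last exact: ltnW.
by rewrite modnDr modn_small.
Qed.

Section Orientation.
Variables (R : realFieldType) (V : finType) (l : nat).
Variables (f : 'I_l -> V) (o : 'I_l -> bool).
Hypotheses (l2 : (2 < l)%N) (fI : injective f).

Definition cycle_arc (i : 'I_l) : V * V :=
  if o i then (f i, f (ordS i)) else (f (ordS i), f i).
Definition arcs : {set V * V} := [set cycle_arc i | i : 'I_l].

(** Two edges joining the same vertices crosswise would give j + 2 = j modulo [l], which l > 2
    forbids. *)
Lemma ordS_cross (i j : 'I_l) : f i = f (ordS j) -> f (ordS i) = f j -> False.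
Proof.
by move=> /fI -> /fI /eqP; rewrite (negbTE (ordS_iter2_neq _ l2)).
Qed.

Lemma arc_inj : injective cycle_arc.
Proof.
move=> i j; rewrite /cycle_arc; case: (o i); case: (o j) => -[].
- by move/fI.
- by move=> p q; case: (ordS_cross p q).
- by move=> p q; case: (ordS_cross q p).
- by move=> _ /fI.
Qed.

Lemma mem_arcs i : cycle_arc i \in arcs.
Proof. exact: imset_f. Qed.

Lemma arcs_oriented : oriented arcs.
Proof.
move=> e /imsetP[i _ ->]; apply/negP => /imsetP[j _].
rewrite /cycle_arc; case oi: (o i); case oj: (o j) => /= -[] p q.
- exact: ordS_cross q p.
- by move/fI: q oi oj => -> ->.
- by move/fI: p oi oj => -> ->.
- exact: ordS_cross p q.
Qed.

Lemma card_arcs : #|arcs| = l.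
Proof. by rewrite card_imset ?card_ord //; exact: arc_inj. Qed.

Lemma prod_arcs (F : V * V -> R) : \prod_(e in arcs) F e = \prod_i F (cycle_arc i).
Proof. by rewrite big_imset //; move=> i j _ _ /arc_inj. Qed.

(** The exclusive or makes incidence with [f j] independent of the orientation, since reversing an
    arc only swaps the two terms. *)
Lemma arc_incident i j :
  ((cycle_arc i).1 == f j) (+) ((cycle_arc i).2 == f j) = (i == j) (+) (ordS i == j).
Proof.
by rewrite /cycle_arc; case: (o i); rewrite /= !(inj_eq fI) // addbC.
Qed.

(** Exchanging the colours of the two ends of [e] negates its factor and fixes all others. This
    covers both a single arc and two disjoint arcs. *)
Lemma col_sum_isolated_arc (F : {set V * V}) e : e \in F -> e.1 != e.2 ->
  (forall e', e' \in F -> e' != e -> forall z, z \in [:: e'.1; e'.2] ->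
     (z != e.1) && (z != e.2)) ->
  col_sum (udiff R) F = 0.
Proof.
move=> eF e12 dis.
pose h (phi : {ffun V -> K}) : {ffun V -> K} :=
  [ffun z => phi (tperm e.1 e.2 z)].
apply: (@sum_antisym _ _ h).
  move=> p q /ffunP pq; apply/ffunP => z.
  by have := pq (tperm e.1 e.2 z); rewrite !ffunE tpermK.
move=> phi; rewrite /col_prod (bigD1 e) //= [in RHS](bigD1 e) //= -mulNr.
congr (_ * _); first by rewrite !ffunE tpermL tpermR udiffN.
apply: eq_bigr => e' /andP[e'F e'e]; rewrite !ffunE.
have /andP[a1 a2] := dis _ e'F e'e _ (mem_head _ _).
have /andP[b1 b2] : (e'.2 != e.1) && (e'.2 != e.2).
  by apply: (dis _ e'F e'e); rewrite !inE eqxx orbT.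
by rewrite !tpermD // eq_sym.
Qed.

Lemma arc_loopless i : (cycle_arc i).1 != (cycle_arc i).2.
Proof.
by rewrite /cycle_arc; case: (o i); rewrite /= (inj_eq fI) ?ordS_neq // eq_sym ordS_neq.
Qed.

Lemma col_sum_arc i : col_sum (udiff R) [set cycle_arc i] = 0.
Proof.
apply: (@col_sum_isolated_arc _ (cycle_arc i)); rewrite ?inE ?arc_loopless //.
by move=> e'; rewrite inE => ->.
Qed.

Lemma obtained_Q2_consecutive i :
  exists p, obtained p Q2 [set cycle_arc i; cycle_arc (ordS i)].
Proof.
have := @obtained_Q2_cherry V (f (ordS i)) (f i) (f (ordS (ordS i)))
  (~~ o i) (o (ordS i)).
rewrite !(inj_eq fI) ordS_neq // eq_sym ordS_neq // eq_sym ordS_iter2_neq //.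
move=> /(_ isT isT isT) [p hp]; exists p; move: hp; congr (obtained _ _ _).
by rewrite /cycle_arc; case: (o i); case: (o _).
Qed.

(** Two distinct arcs are either consecutive on the cycle, hence a reoriented [Q2], or
    vertex-disjoint, hence of zero sum. *)
Lemma cycle_arc_pair i j : i != j ->
  col_sum (udiff R) [set cycle_arc i; cycle_arc j] = 0 \/
  exists p, obtained p Q2 [set cycle_arc i; cycle_arc j].
Proof.
move=> ij; case: (eqVneq j (ordS i)) => [->|ji].
  by right; exact: obtained_Q2_consecutive.
case: (eqVneq i (ordS j)) => [->|ij'].
  by right; rewrite setUC; exact: obtained_Q2_consecutive.
left; apply: (@col_sum_isolated_arc _ (cycle_arc i)); rewrite ?inE ?eqxx //.
  exact: arc_loopless.
move=> e'; rewrite !inE => /orP[/eqP -> /eqP//|/eqP -> _] z.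
have ends k : z \in [:: (cycle_arc k).1; (cycle_arc k).2] -> z = f k \/ z = f (ordS k).
  by rewrite /cycle_arc !inE; case: (o k) => /= /orP[]/eqP ->; auto.
move=> /ends zj.
have : (z != f i) && (z != f (ordS i)).
  case: zj => ->; rewrite !(inj_eq fI) ?(inj_eq (@ordS_inj _)).
    by rewrite [j == i]eq_sym ij.
  by rewrite [j == i]eq_sym ij [_ == i]eq_sym ij'.
by rewrite /cycle_arc; case: (o i) => //=; rewrite andbC.
Qed.

Definition cherry_sign (W : finType) (F : {set W * W}) : R :=
  (obtained false Q2 F)%:R - (obtained true Q2 F)%:R.

Lemma col_sum_card2 (F : {set V * V}) : F \subset arcs -> #|F| = 2 ->
  col_sum (udiff R) F = cherry_sign F * #|{ffun V -> K}|%:R.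
Proof.
move=> /subsetP FC F2; set N : R := _%:R.
have N0 : 0 < N.
  by rewrite ltr0n; apply/card_gt0P; exists [ffun=> (true, true)].
have S p : obtained p Q2 F -> col_sum (udiff R) F = (-1) ^+ p * N.
  exact: obtained_Q2_sum.
have : col_sum (udiff R) F = 0 \/ exists p, obtained p Q2 F.
  move/eqP: F2 => /cards2P[e [e' [ee' FE]]].
  have : e \in arcs by apply: FC; rewrite FE !inE eqxx.
  have : e' \in arcs by apply: FC; rewrite FE !inE eqxx orbT.
  move=> /imsetP[j _ ej] /imsetP[i _ ei]; rewrite FE ei ej.
  by apply: cycle_arc_pair; apply: contraNneq ee' => ij; rewrite ei ej ij.
rewrite /cherry_sign.
case h0: (obtained false Q2 F); case h1: (obtained true Q2 F).
(* Both parities at once would give N = -N, against N > 0. *)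
- by have := S _ h0; rewrite (S _ h1) /= expr0 expr1; lra.
- by move=> _; rewrite (S _ h0) subr0.
- by move=> _; rewrite (S _ h1) sub0r.
- by rewrite subrr mul0r => -[//|[[]]]; rewrite ?h0 ?h1.
Qed.

Lemma sum_cherry_sign :
  \sum_(F : {set V * V} | F \subset arcs) cherry_sign F = (alpha2 arcs)%:~R.
Proof.
rewrite /alpha2 intrB sumrB; congr (_ - _); rewrite -!sum1_card;
  rewrite -[RHS]/((\sum_(_ in _) 1)%N%:R) natr_sum big_mkcond [RHS]big_mkcond /=;
  apply: eq_bigr => F _; rewrite inE; case: (_ \subset _) => //=; by case: obtained.
Qed.

(** Expand over the set [F] of arcs that take the term in [a]: the empty set gives the constant,
    single arcs vanish, pairs sum to [alpha2], and larger sets are of order a^3. The bound [B] does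
    not depend on [a], which can therefore be chosen after it. *)
Lemma col_sum_expand : exists B : R, 0 <= B /\
  forall a, 0 <= a <= 1 -> exists2 r, `|r| <= B &
  col_sum (fun x y => a * udiff R x y + 2^-1) arcs =
  #|{ffun V -> K}|%:R / 2 ^+ l +
  a ^+ 2 * (2^-1 ^+ (l - 2) * (#|{ffun V -> K}|%:R * (alpha2 arcs)%:~R) + a * r).
Proof.
set N : R := #|{ffun V -> K}|%:R.
exists (\sum_(F : {set V * V} | F \subset arcs) `|col_sum (udiff R) F|).
split; first exact: sumr_ge0.
move=> a /andP[a0 a1].
(* The terms of order at least 3, with a^3 factored out. *)
pose r (F : {set V * V}) : R := if (2 < #|F|)%N then
  2^-1 ^+ (l - #|F|) * a ^+ (#|F| - 3) * col_sum (udiff R) F else 0.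
exists (\sum_(F : {set V * V} | F \subset arcs) r F).
  apply: le_trans (ler_norm_sum _ _ _) _; apply: ler_sum => F _.
  rewrite /r; case: ifP => _; last by rewrite normr0.
  rewrite !normrM ler_piMl //; apply: mulr_ile1; rewrite ?normr_ge0 // ger0_norm.
  - by apply: exprn_ile1; lra.
  - by apply: exprn_ge0; lra.
  - exact: exprn_ile1.
  - exact: exprn_ge0.
rewrite -sum_cherry_sign.
(* The constant is attributed to the empty set, so that the identity can be checked separately for
   each [F]. *)
have -> : N / 2 ^+ l = \sum_(F : {set V * V} | F \subset arcs)
    (if F == set0 then N / 2 ^+ l else 0).
  rewrite -big_mkcondr /= (big_pred1 set0) // => F /=.
  by rewrite andbC; case: eqP => // ->; rewrite sub0set.
rewrite 2!mulr_sumr [X in _ * (_ + X)]mulr_sumr -big_split /= mulr_sumr.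
rewrite -big_split /= /col_sum /col_prod /=.
under eq_bigr => phi _ do rewrite prodD_subset.
rewrite exchange_big /=; apply: eq_bigr => F FC.
rewrite (eq_bigr (fun phi : {ffun V -> K} =>
  a ^+ #|F| * 2^-1 ^+ (l - #|F|) * \prod_(e in F) udiff R (phi e.1) (phi e.2)));
  last first.
  move=> phi _; rewrite big_split /= !prodr_const cardsD (setIidPr FC) card_arcs.
  by rewrite mulrAC.
rewrite -mulr_sumr -[X in _ * X]/(col_sum (udiff R) F) /r.
have cs2 : #|F| != 2 -> cherry_sign F = 0.
  move=> h; rewrite /cherry_sign.
  case h0: (obtained false Q2 F).
    by move: h; rewrite (obtained_Q2_card h0).
  case h1: (obtained true Q2 F); last by rewrite subrr.
  by move: h; rewrite (obtained_Q2_card h1).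
case: ltngtP => F2.
- rewrite cs2 ?(gtn_eqF F2) // !mulr0 add0r.
  have -> : (F == set0) = false by rewrite -cards_eq0; case: #|F| F2.
  by rewrite add0r -{1}(subnK F2) exprD; ring.
- rewrite cs2 ?(ltn_eqF F2) // !mulr0 addr0 mulr0 addr0.
  case: eqP => [->|/eqP F0].
    rewrite cards0 expr0 mul1r subn0 mulrC exprVn; congr (_ / _).
    rewrite /col_sum /col_prod.
    by under eq_bigr => phi _ do rewrite big_set0; rewrite sumr_const.
  have /eqP/cards1P[e Fe] : #|F| = 1%N.
    by move: F0 F2; rewrite -cards_eq0; case: #|F| => [|[|]].
  rewrite Fe in FC *; move: FC; rewrite sub1set => /imsetP[i _ ->].
  by rewrite col_sum_arc mulr0.
- have -> : (F == set0) = false by rewrite -cards_eq0 -F2.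
  by rewrite -F2 add0r mulr0 addr0 col_sum_card2 //; ring.
Qed.

(** The vertex [f (ordS i)] lies on the arcs i and i + 1 only, and just the first is in [J].
    Flipping v there negates that one factor and leaves u unchanged. *)
Lemma prod_vudiff_flip (J : {set V * V}) i (phi : {ffun V -> K}) b :
  J \subset arcs -> cycle_arc i \in J -> cycle_arc (ordS i) \notin J ->
  \prod_(e in J) (b * vudiff R (recolour flip2 (f (ordS i)) phi e.1)
                             (recolour flip2 (f (ordS i)) phi e.2)) =
  - \prod_(e in J) (b * vudiff R (phi e.1) (phi e.2)).
Proof.
move=> /subsetP JC iJ iSJ; set x := f (ordS i); set phi' := recolour _ _ _.
have uE z : usgn R (phi' z) = usgn R (phi z) by rewrite ffunE; case: eqP.
have vE z : vsgn R (phi' z) = (-1) ^+ (z == x) * vsgn R (phi z).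
  by rewrite ffunE; case: eqP; rewrite ?vsgn_flip2 ?mulN1r ?mul1r.
have vuE e : vudiff R (phi' e.1) (phi' e.2) =
    (-1) ^+ ((e.1 == x) (+) (e.2 == x)) * vudiff R (phi e.1) (phi e.2).
  by rewrite /vudiff /udiff !uE !vE signr_addb; ring.
rewrite (bigD1 (cycle_arc i)) //= [in RHS](bigD1 (cycle_arc i)) //= -mulNr.
congr (_ * _).
  by rewrite vuE arc_incident eqxx [i == _]eq_sym (negbTE (ordS_neq i l2)); ring.
apply: eq_bigr => e /andP[eJ ei]; rewrite vuE.
have /imsetP[j _ ej] := JC _ eJ; rewrite ej arc_incident (inj_eq (@ordS_inj _)).
have -> : (j == ordS i) = false.
  by apply: contraNF iSJ => /eqP <-; rewrite -ej.
have -> : (j == i) = false by apply: contraNF ei => /eqP <-; rewrite -ej.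
by rewrite mul1r.
Qed.

(* Flipping the second bit at a vertex where exactly one of the two incident
   arcs carries vudiff changes the sign of the product. *)
Lemma col_sum_split a b :
  col_sum (fun x y => b * vudiff R x y + (a * udiff R x y + 2^-1)) arcs =
  col_sum (fun x y => a * udiff R x y + 2^-1) arcs +
  b ^+ l * col_sum (vudiff R) arcs.
Proof.
rewrite /col_sum /col_prod /=.
under eq_bigr => phi _ do rewrite prodD_subset.
rewrite exchange_big /= (bigD1 set0) ?sub0set //=; congr (_ + _).
  by apply: eq_bigr => phi _; rewrite big_set0 mul1r setD0.
have C0 : arcs != set0.
  by rewrite -cards_eq0 card_arcs; case: (l) l2.
rewrite (bigD1 arcs) ?subxx //= [X in _ + X]big1 ?addr0.
  rewrite mulr_sumr; apply: eq_bigr => phi _.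
  by rewrite setDv big_set0 mulr1 big_split /= prodr_const card_arcs.
move=> J /andP[/andP[JC J0] JT].
(* Otherwise [J] would be closed under the successor and, being non-empty, contain every arc. *)
have [i iJ iSJ] : exists2 i, cycle_arc i \in J & cycle_arc (ordS i) \notin J.
  apply/exists_inP; apply: contraNT JT; rewrite negb_exists_in => /forall_inP h.
  case/set0Pn: J0 => e eJ; rewrite eqEsubset JC.
  apply/subsetP => e' /imsetP[j _ ->].
  have /imsetP[i _ ei] := subsetP JC _ eJ.
  apply: (@ordS_closed _ (fun k => cycle_arc k \in J) _ i); last by rewrite -ei.
  by move=> k kJ; have := h _ kJ; rewrite negbK.
apply: (@sum_antisym _ _ (recolour flip2 (f (ordS i)))).
  exact/recolour_inj/flip2_inj.
move=> phi; rewrite prod_vudiff_flip // mulNr; congr (- (_ * _)).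
apply: eq_bigr => e _; rewrite /udiff /usgn !ffunE.
by case: ifP; case: ifP.
Qed.

(** Each vertex lies on two arcs, so the v signs cancel in squares; each arc against the cyclic
    order costs a factor -1. *)
Lemma prod_vudiff phi : col_prod (vudiff R) arcs phi =
  \prod_i (-1) ^+ (~~ o i) *
  \prod_i (usgn R (phi (f (ordS i))) - usgn R (phi (f i))).
Proof.
rewrite /col_prod prod_arcs -big_split /=.
have E : \prod_i (vsgn R (phi (f (ordS i))) * vsgn R (phi (f i))) = 1.
  rewrite big_split /=.
  have -> : \prod_i vsgn R (phi (f (ordS i))) = \prod_i vsgn R (phi (f i)).
    by rewrite [RHS](reindex_inj (@ordS_inj l)).
  rewrite -big_split /=.
  by rewrite big1 // => i _; rewrite vsgn_sq.
rewrite -[RHS]mul1r -[X in _ = X * _]E -!big_split; apply: eq_bigr => i _ /=.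
rewrite /cycle_arc; case: (o i) => /=; rewrite /vudiff /udiff; ring.
Qed.

End Orientation.
End Cycles.

(** * Sign of the cycle sum of [vudiff], and its agreement with [gamma] *)

Section EvenCycles.
Import boot.fintype boot.finset.
Variable R : realFieldType.
Local Notation K := (bool * bool)%type.

Section Sign.
Variable n : nat.
Hypothesis l2 : (2 < n.*2)%N.

(** Parity also alternates at the wrap-around, because the last index n.*2 - 1 is odd and its
    successor is 0. *)
Lemma odd_ordS (i : 'I_n.*2) : odd (ordS i) = ~~ odd i.
Proof.
case: i => i /= ; rewrite leq_eqVlt => /predU1P[e|h].
  by have := odd_double n; rewrite -e modnn /= => ->.
by rewrite modn_small.
Qed.

Lemma prod_sign_odd : \prod_(i < n.*2) (-1) ^+ odd i = (-1) ^+ n :> R.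
Proof.
elim: n => [|k IH]; first by rewrite big_ord0.
rewrite doubleS !big_ord_recr /= IH /= odd_double /= expr0 expr1 exprS.
by ring.
Qed.

Definition sign_step (w : 'I_n.*2 -> bool) : R :=
  \prod_i ((-1) ^+ w (ordS i) - (-1) ^+ w i).

Lemma sign_step_odd : (-1) ^+ n * sign_step (fun i => odd i) = 2 ^+ n.*2.
Proof.
rewrite /sign_step (eq_bigr (fun i : 'I_n.*2 => - 2 * (-1) ^+ odd i)); last first.
  by move=> i _; rewrite odd_ordS; case: odd; rewrite /= ?expr0 ?expr1; ring.
rewrite big_split /= prod_sign_odd prodr_const card_ord mulrCA -expr2 sqrr_sign.
by rewrite mulr1 exprNn -signr_odd odd_double mul1r.
Qed.

(** The product vanishes unless [w] alternates around the cycle. An alternating [w] is the parity of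
    the index up to a global complement, which changes an even number of signs. *)
Lemma sign_step_ge0 w : 0 <= (-1) ^+ n * sign_step w.
Proof.
case: (boolP [forall i, w (ordS i) != w i]) => [/forallP h|]; last first.
  rewrite negb_forall => /existsP[i]; rewrite negbK => /eqP e.
  by rewrite /sign_step (bigD1 i) //= e subrr mul0r mulr0.
pose i0 := Ordinal (ltn_trans (isT : 0 < 2)%N l2).
have wE i : w i = w i0 (+) odd i.
  have := @ordS_closed _ (fun i => w i == w i0 (+) odd i) _ i0 i.
  rewrite /= addbF eqxx => H; apply/eqP; apply: H => // j /eqP e.
  by have := h j; rewrite odd_ordS e; case: (w _); case: (w _); case: odd.
have -> : sign_step w = sign_step (fun i => odd i).
  rewrite /sign_step (eq_bigr (fun i : 'I_n.*2 => (-1) ^+ w i0 *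
    ((-1) ^+ odd (ordS i) - (-1) ^+ odd i))); last first.
    by move=> i _; rewrite (wE i) (wE (ordS i)) !signr_addb mulrBr.
  by rewrite big_split /= prodr_const card_ord -exprM mulnC exprM
    -[(-1) ^+ n.*2]signr_odd odd_double expr1n mul1r.
by rewrite sign_step_odd exprn_ge0.
Qed.

Section Orientation.
Variables (V : finType) (f : 'I_n.*2 -> V) (o : 'I_n.*2 -> bool).
Hypothesis (fB : bijective f).

(** A closed form of [gamma]: the factor (-1)^n normalises it to 1 on D_{2n}, which has exactly n
    arcs against the cyclic order. *)
Definition orientation_sign : R := (-1) ^+ n * \prod_i (-1) ^+ (~~ o i).

Lemma orientation_sign_sq : orientation_sign * orientation_sign = 1.
Proof.
rewrite /orientation_sign mulrACA -expr2 sqrr_sign mul1r -big_split /= big1 //.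
by move=> i _; rewrite -expr2 sqrr_sign.
Qed.

Lemma orientation_sign_prod phi :
  orientation_sign * col_prod (vudiff R) (arcs f o) phi =
  (-1) ^+ n * sign_step (fun i => (phi (f i)).1).
Proof.
rewrite (prod_vudiff _ _ l2 (bij_inj fB)) /orientation_sign.
rewrite mulrA -(mulrA ((-1) ^+ n)) -big_split /= big1 ?mulr1 // => i _.
by rewrite -expr2 sqrr_sign.
Qed.

Lemma orientation_sign_prod_ge0 phi :
  0 <= orientation_sign * col_prod (vudiff R) (arcs f o) phi.
Proof. by rewrite orientation_sign_prod sign_step_ge0. Qed.

Lemma orientation_sign_prod_gt0 : exists phi,
  0 < orientation_sign * col_prod (vudiff R) (arcs f o) phi.
Proof.
(* The colouring whose first bit alternates around the cycle makes every factor non-zero. *)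
have [g fK gK] := fB; exists [ffun v => (odd (g v), false)].
rewrite orientation_sign_prod (_ : sign_step _ = sign_step (fun i => odd i)).
  by rewrite sign_step_odd exprn_gt0.
by apply: eq_bigr => i _; rewrite !ffunE !fK.
Qed.

Lemma orientation_sign_sum_gt0 :
  0 < orientation_sign * col_sum (vudiff R) (arcs f o).
Proof.
rewrite mulr_sumr; have [phi h] := orientation_sign_prod_gt0.
rewrite (bigD1 phi) //= ltr_pwDl //; apply: sumr_ge0 => psi _.
exact: orientation_sign_prod_ge0.
Qed.
End Orientation.
End Sign.

Section Gamma.
Variable n : nat.
Hypothesis l2 : (2 < n.*2)%N.

Definition Dorient (i : 'I_n.*2) := (i < n)%N.

Lemma Dcycle_arcs : Dcycle n = arcs id Dorient.
Proof. by []. Qed.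

Lemma Dorient_sign : orientation_sign Dorient = 1.
Proof.
rewrite /orientation_sign -(big_mkord xpredT (fun i => (-1) ^+ ~~ (i < n)%N)).
rewrite (big_cat_nat (n := n)) //=; last by rewrite -addnn leq_addr.
rewrite big_nat big1 => [|i /andP[_ ->] //].
rewrite big_nat (eq_bigr (fun=> -1)) => [|i /andP[ni _]]; last by rewrite ltnNge ni.
rewrite -big_nat prodr_const_nat -addnn addnK mul1r -expr2 sqrr_sign //.
Qed.

Variables (V : finType) (f : 'I_n.*2 -> V) (o : 'I_n.*2 -> bool).
Hypothesis (fB : bijective f).

(** The embedding [g] need not respect the cyclic labelling [f], so orientations are not compared
    arc by arc. Instead, all colour products of D_{2n} are non-negative, an even number of reversals
    preserves this, and sign -1 would yield a negative product. *)
Lemma obtained_orientation_sign :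
  obtained false (Dcycle n) (arcs f o) -> orientation_sign o = 1.
Proof.
have oD : oriented (Dcycle n) by rewrite Dcycle_arcs; exact: arcs_oriented.
case/(obtained_col_prod (@vudiffN R) oD) => g gI gE.
have [phi h] := orientation_sign_prod_gt0 l2 o fB.
have : 0 <= col_prod (vudiff R) (arcs f o) phi.
  have idB : bijective (@id 'I_n.*2) by exists id.
  have := orientation_sign_prod_ge0 l2 Dorient idB [ffun i => phi (g i)].
  rewrite Dorient_sign mul1r gE mul1r /col_prod Dcycle_arcs.
  by under eq_bigr => e _ do rewrite !ffunE.
have /eqP := orientation_sign_sq o.
rewrite -expr2 sqrf_eq1 => /orP[/eqP //|/eqP sE]; move: h; rewrite sE mulN1r.
by move=> ? ?; lra.
Qed.

(** Reverse exactly the arcs on which [o] and [Dorient] disagree; their number is even because the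
    two signs agree. *)
Lemma orientation_sign_obtained :
  orientation_sign o = 1 -> obtained false (Dcycle n) (arcs f o).
Proof.
move=> s1; rewrite Dcycle_arcs.
pose Darc := cycle_arc id Dorient.
have DI : injective Darc by apply: arc_inj.
pose P := [set i | o i != Dorient i].
apply/existsP; exists (Darc @: P).
apply/existsP; exists [ffun i => f i]; apply/and4P; split.
- by apply/subsetP => e /imsetP[i _ ->]; exact: mem_arcs.
- rewrite card_imset // eqbF_neg.
  have E : \prod_i (-1) ^+ (~~ o i) = \prod_i (-1) ^+ (~~ Dorient i) :> R.
    apply: (@mulfI _ ((-1) ^+ n)); first by rewrite signr_eq0.
    exact: etrans s1 (esym Dorient_sign).
  have : (-1) ^+ #|P| = 1 :> R.
    rewrite -prodr_const big_mkcond /=.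
    rewrite (eq_bigr (fun i => (-1) ^+ (~~ o i) * (-1) ^+ (~~ Dorient i))).
      by rewrite big_split /= E -big_split /= big1 // => i _; rewrite -expr2 sqrr_sign.
    by move=> i _; rewrite inE; case: (o i); case: Dorient => /=; ring.
  rewrite -signr_odd; case: odd => //= /eqP; rewrite expr1 => /eqP; lra.
- by apply/injectiveP => i j; rewrite !ffunE => /(bij_inj fB).
have DP i : (Darc i \in Darc @: P) = (i \in P) by rewrite mem_imset.
have -> : reverse_arcs (arcs id Dorient) (Darc @: P) = arcs id o.
  apply/setP => e; apply/idP/imsetP => [|[i _ ->]].
    rewrite inE => /orP[|/imsetP[_ /imsetP[i iP ->] ->]].
      move=> /setDP[/imsetP[i _ ->]]; rewrite DP inE negbK => /eqP oi.
      by exists i => //; rewrite /cycle_arc oi.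
    exists i => //; move: iP; rewrite inE /Darc /cycle_arc.
    by case: (o i); case: Dorient.
  rewrite inE; case: (boolP (i \in P)) => iP; apply/orP.
    right; apply/imsetP; exists (Darc i); first by rewrite DP.
    by move: iP; rewrite inE /Darc /cycle_arc; case: (o i); case: Dorient.
  left; have -> : cycle_arc id o i = Darc i.
    by move: iP; rewrite inE negbK /Darc /cycle_arc => /eqP ->.
  by rewrite inE DP iP mem_arcs.
rewrite /arcs -imset_comp; apply/eqP; apply: eq_imset => i /=.
by rewrite /cycle_arc; case: (o i); rewrite !ffunE.
Qed.

Lemma gamma_orientation_sign : (gamma (arcs f o))%:~R = orientation_sign o.
Proof.
rewrite /gamma card_arcs ?doubleK //; last exact: bij_inj.
case: ifPn => [/obtained_orientation_sign -> //|h].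
have /eqP := orientation_sign_sq o; rewrite -expr2 sqrf_eq1 => /orP[]/eqP // e.
by rewrite orientation_sign_obtained in h.
Qed.

End Gamma.
End EvenCycles.

(** * Densities of step kernels *)

Section StepKernels.
Local Open Scope classical_set_scope.
Variable R : realType.
Local Notation mR := (measurableTypeR R).

Lemma unif01E (A : set mR) : measurable A ->
  @unif01 R A = lebesgue_measure (A `&` `[0, 1]).
Proof.
move=> mA; rewrite /unif01 /= /uniform_prob integral_uniform_pdf.
rewrite (eq_integral (cst 1%E)); last first.
  move=> x; rewrite inE => -[_]; rewrite /= in_itv /= => x01.
  by rewrite /uniform_pdf x01 subr0 invr1.
by rewrite integral_cst ?mul1e //; exact: measurableI.
Qed.

Lemma measurable_box n (A : 'I_n -> set mR) : (forall i, measurable (A i)) ->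
  measurable [set x : n.-tuple mR | forall i, A i (tnth x i)].
Proof.
move=> mA; rewrite (_ : [set _ | _] =
  \bigcap_(i in [set: 'I_n]) ((fun x : n.-tuple mR => tnth x i) @^-1` (A i))).
  apply: fin_bigcap_measurable => [|i _]; first exact: finite_finset.
  rewrite -[X in measurable X]setTI; exact: measurable_tnth.
by apply/seteqP; split => x /= h i; [move=> _|]; exact: h.
Qed.

(** Induction on [n]: along [cons_pair] the box pulls back to a rectangle, whose product measure
    factors. *)
Lemma unif_cube_box n (A : 'I_n -> set mR) : (forall i, measurable (A i)) ->
  @unif_cube R n [set x | forall i, A i (tnth x i)] = (\prod_i unif01 (A i))%E.
Proof.
elim: n A => [|n IH] A mA.
  rewrite big_ord0 /= diracE mem_set // => -[].
  done.
rewrite big_ord_recl -(IH (fun i => A (lift ord0 i))) // -product_measure1E //; last first.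
  exact: (@measurable_box n (fun i => A (lift ord0 i))).
rewrite /= /distribution /pushforward; congr (_ _).
apply/seteqP; split => -[z x] /=.
  move=> h; split; first by have := h ord0; rewrite tnth0.
  by move=> i; have := h (lift ord0 i); rewrite tnthS.
move=> [h0 h] i; case: (unliftP ord0 i) => [j ->|->].
  by rewrite tnthS.
by rewrite tnth0.
Qed.

Lemma measurable_cube n : measurable (@cube R n).
Proof.
rewrite (_ : @cube R n = [set x : n.-tuple mR | forall i, `[0, 1] (tnth x i)]).
  by apply: (@measurable_box n (fun=> `[0, 1])).
by apply/seteqP; split => x h i; have := h i; rewrite /= inE.
Qed.

Section StepFunction.
Variables (K : finType) (st : R -> K) (p : R).

Definition step_cell (k : K) : set mR := [set x | `[0, 1] x /\ st x = k].

Hypothesis mcell : forall k, measurable (step_cell k).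
Hypothesis pcell : forall k, unif01 (step_cell k) = p%:E.

Definition step_box n (psi : {ffun 'I_n -> K}) : set (n.-tuple mR) :=
  [set x | forall i, step_cell (psi i) (tnth x i)].

Lemma measurable_step_box n (psi : {ffun 'I_n -> K}) : measurable (step_box psi).
Proof. exact: (@measurable_box n (fun i => step_cell (psi i))). Qed.

(** On the cube the integrand is a finite combination of indicators of boxes of cells, each box
    having measure p^n. *)
Lemma Rintegral_step n (G : {ffun 'I_n -> K} -> R) :
  \int[@unif_cube R n]_(x in @cube R n) G [ffun i => st (tnth x i)] =
  p ^+ n * \sum_psi G psi.
Proof.
rewrite /Rintegral.
have -> : (\int[@unif_cube R n]_(x in @cube R n)
    (G [ffun i => st (tnth x i)])%:E =
  \int[@unif_cube R n]_(x in @cube R n)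
    \sum_psi ((G psi)%:E * (\1_(step_box psi) x)%:E))%E.
  apply: eq_integral => x; rewrite inE => xc.
  rewrite (bigD1 [ffun i => st (tnth x i)]) //= big1 ?adde0.
    rewrite indicE mem_set ?mule1 // => i; split; last by rewrite ffunE.
    by have := xc i; rewrite inE.
  move=> psi psix; rewrite indicE memNset ?mule0 //= => h.
  move/negP: psix; apply; apply/eqP/ffunP => i; rewrite ffunE.
  by have [] := h i.
have int1 psi : (@unif_cube R n).-integrable (@cube R n)
    (fun x => (\1_(step_box psi) x)%:E).
  apply: (@integrableS _ _ _ _ setT) => //; first exact: measurable_cube.
  by apply: integrable_indic; exact: measurable_step_box.
rewrite integral_sum; [|exact: measurable_cube|]; last first.
  by move=> psi; apply: integrableZl => //; exact: measurable_cube.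
rewrite mulr_sumr -[RHS]/(fine (_%:E)) -sumEFin; congr fine.
apply: eq_bigr => psi _; rewrite integralZl //; last exact: measurable_cube.
rewrite integral_indic; [|exact: measurable_cube|exact: measurable_step_box].
rewrite setIidl; last by move=> x h i; have [? _] := h i; rewrite inE.
rewrite EFinM muleC; congr (_ * _)%E.
transitivity (\prod_(i < n) @unif01 R (step_cell (psi i)))%E.
  exact: (@unif_cube_box n (fun i => step_cell (psi i))).
rewrite (eq_bigr (fun=> p%:E)) // prodEFin prodr_const card_ord //.
Qed.

Lemma hom_density_step (V : finType) (H : {set V * V}) (M : K -> K -> R) :
  hom_density H (fun x y => M (st x) (st y)) =
  p ^+ #|V| * \sum_(phi : {ffun V -> K}) \prod_(e in H) M (phi e.1) (phi e.2).
Proof.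
rewrite /hom_density.
pose G (psi : {ffun 'I_#|V| -> K}) : R :=
  \prod_(e in H) M (psi (enum_rank e.1)) (psi (enum_rank e.2)).
have -> : \int[@unif_cube R #|V|]_(x in @cube R #|V|)
    \prod_(e in H) M (st (tnth x (enum_rank e.1))) (st (tnth x (enum_rank e.2)))
  = \int[@unif_cube R #|V|]_(x in @cube R #|V|) G [ffun i => st (tnth x i)].
  by apply: eq_Rintegral => x _; apply: eq_bigr => e _; rewrite !ffunE.
rewrite Rintegral_step; congr (_ * _).
(* Coordinates are indexed by ranks and colourings by vertices; [enum_rank] matches the two. *)
rewrite [RHS](reindex (fun psi : {ffun 'I_#|V| -> K} =>
  [ffun v => psi (enum_rank v)])) /=.
  by apply: eq_bigr => psi _; apply: eq_bigr => e _; rewrite !ffunE.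
exists (fun phi : {ffun V -> K} => [ffun i => phi (enum_val i)]) => phi _;
  by apply/ffunP => i; rewrite !ffunE ?enum_valK ?enum_rankK.
Qed.

Lemma step_kernel_measurable (M : K -> K -> R) :
  measurable_fun (@square R) (fun z => M (st z.1) (st z.2)).
Proof.
apply: (@eq_measurable_fun _ _ _ _ _ (fun z : mR * mR =>
   \sum_(k : K * K) M k.1 k.2 * \1_(step_cell k.1 `*` step_cell k.2) z)).
  move=> z; rewrite inE => -[z1 z2].
  rewrite (bigD1 (st z.1, st z.2)) //= big1 ?addr0.
    by rewrite indicE mem_set ?mulr1.
  move=> k kz; rewrite indicE memNset ?mulr0 //= => -[[_ h1] [_ h2]].
  by move/negP: kz; apply; rewrite h1 h2 -surjective_pairing.
apply: measurable_sum => k; apply: measurable_funM; first exact: measurable_cst.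
by apply: measurable_indic; apply: measurableX.
Qed.

Hypothesis p0 : 0 < p.

(** A rectangle of two cells has measure p^2 > 0, so an almost everywhere constant step kernel takes
    that constant on every pair of cells. *)
Lemma step_kernel_ae (M : K -> K -> R) (c : R) (k k' : K) :
  {ae (@unif01 R \x @unif01 R)%E, forall z, @square R z ->
    M (st z.1) (st z.2) = c} -> M k k' = c.
Proof.
move=> h; apply: contrapT => Mc.
have : (@unif01 R \x @unif01 R)%E (step_cell k `*` step_cell k') = 0%E.
  apply: measure_negligible; first exact: measurableX.
  apply: negligibleS h => z /= [[z1 k1] [z2 k2]] H; apply: Mc.
  by rewrite -k1 -k2; apply: H; split.
have -> : (@unif01 R \x @unif01 R)%E (step_cell k `*` step_cell k') = (p * p)%:E.
  by rewrite product_measure1E // EFinM; congr (_ * _)%E; exact: pcell.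
move=> -[] /eqP; by rewrite mulf_eq0 orbb gt_eqF.
Qed.

End StepFunction.
End StepKernels.

(** * The partition of [0,1] into quarters *)

Section QuarterSteps.
Local Open Scope classical_set_scope.
Variable R : realType.
Local Notation K := (bool * bool)%type.

Definition quarter (x : R) : K :=
  (x < 2^-1, if x < 2^-1 then x < 4^-1 else x < 3 / 4).

Definition quarter_itv (k : K) : interval R :=
  match k with
  | (true, true) => `[0, 4^-1[%R
  | (true, false) => `[4^-1, 2^-1[%R
  | (false, true) => `[2^-1, 3 / 4[%R
  | (false, false) => `[3 / 4, 1]%R
  end.

Lemma quarter_cellE k : step_cell quarter k = [set` quarter_itv k].
Proof.
apply/seteqP; split => x; rewrite /step_cell /quarter /= in_itv /=.
  move=> [/andP[x0 x1] <-].
  case: (ltrP x 2^-1) => h; [case: (ltrP x 4^-1)|case: (ltrP x (3 / 4))] => h';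
    by rewrite /= in_itv /=; apply/andP; split; lra.
case: k => [[] []] /=; rewrite in_itv /= => /andP[h1 h2];
  (split; first by apply/andP; split; lra);
  case: (ltrP x 2^-1) => h; case: (ltrP x 4^-1) => h';
  by case: (ltrP x (3 / 4)) => h''; rewrite //=; exfalso; lra.
Qed.

Lemma measurable_quarter_cell k : measurable (step_cell quarter k).
Proof. by rewrite quarter_cellE. Qed.

Lemma unif01_quarter_cell k : @unif01 R (step_cell quarter k) = (4^-1)%:E.
Proof.
rewrite unif01E; last exact: measurable_quarter_cell.
rewrite setIidl; last by move=> x [].
rewrite quarter_cellE lebesgue_measure_itv.
by case: k => [[] []] /=; rewrite lte_fin ifT -?EFinB; try (congr (_%:E)); lra.
Qed.

End QuarterSteps.

(** * Choice of the parameters *)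

Lemma sg_neq_mul_lt0 (R : realDomainType) (x y : R) :
  x != 0 -> y != 0 -> Num.sg x != Num.sg y -> x * y < 0.
Proof.
case: (sgrP x) => // hx _; case: (sgrP y) => // hy _; rewrite ?eqxx // => _.
  by rewrite pmulr_rlt0.
by rewrite nmulr_rlt0.
Qed.

(** The witness is the inverse of 8 + B/d + (d + B)/e, each summand securing one upper bound. *)
Lemma small_param (R : realFieldType) (B d e : R) : 0 <= B -> 0 < d -> 0 < e ->
  exists a, [/\ 0 < a, a <= 8^-1, a * B <= d & a * (d + B) <= e].
Proof.
move=> B0 d0 e0; pose m := 8 + B / d + (d + B) / e.
have h1 : 0 <= B / d by apply: divr_ge0 => //; exact: ltW.
have h2 : 0 <= (d + B) / e by apply: divr_ge0; [lra | exact: ltW].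
have m0 : 0 < m by rewrite /m; lra.
have key x y : 0 < y -> 0 <= x -> x / y <= m -> m^-1 * x <= y.
  by move=> y0 x0 h; rewrite mulrC ler_pdivrMr // mulrC -ler_pdivrMr.
exists m^-1; split; first by rewrite invr_gt0.
- by rewrite lef_pV2 ?posrE //; rewrite /m; lra.
- by apply: key => //; rewrite /m; lra.
- by apply: key => //; rewrite /m; lra.
Qed.

Lemma small_nth_root (R : realType) (l : nat) (t e : R) : (0 < l)%N ->
  0 <= t -> 0 <= e -> t <= e ^+ l -> exists b, [/\ 0 <= b, b <= e & b ^+ l = t].
Proof.
move=> l0 t0 e0 te; exists (t `^ (l%:R^-1)).
have bE : (t `^ (l%:R^-1)) ^+ l = t.
  rewrite -powR_mulrn ?powR_ge0 // -powRrM mulVf ?powRr1 //.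
  by rewrite pnatr_eq0 -lt0n.
split; rewrite ?powR_ge0 //.
by rewrite -(@ler_pXn2r _ l) ?nnegrE ?powR_ge0 // bE.
Qed.

(** * The perturbed tournamenton *)

Section Kernel.
Variables (R : realFieldType) (a b : R).
Local Notation K := (bool * bool)%type.

Definition kern (x y : K) : R := b * vudiff R x y + (a * udiff R x y + 2^-1).

Lemma kern_skew x y : kern x y + kern y x = 1.
Proof. by rewrite /kern (vudiffN _ x y) (udiffN _ x y); lra. Qed.

(** Both [udiff] and [vudiff] are at most 2 in absolute value, so the deviation from 1/2 is at most
    2a + 2b, which is at most 1/2. *)
Lemma kern_ge0 x y : 0 <= a -> 0 <= b -> a <= 8^-1 -> b <= 8^-1 ->
  0 <= kern x y.
Proof.
move=> a0 b0 a8 b8.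
rewrite /kern /vudiff /udiff /usgn /vsgn.
by case: x y => [[] []] [[] []] /=; rewrite ?expr0 ?expr1; lra.
Qed.

End Kernel.

Lemma kern_tournamenton (R : realType) (a b : R) :
  0 <= a -> 0 <= b -> a <= 8^-1 -> b <= 8^-1 ->
  tournamenton (fun x y : R => kern a b (quarter x) (quarter y)).
Proof.
move=> a0 b0 a8 b8.
have k0 x y : 0 <= kern a b x y by exact: kern_ge0.
have k1 x y : kern a b x y <= 1.
  by have := kern_skew a b x y; have := k0 y x; lra.
split; [split| |].
- apply: step_kernel_measurable => k; exact: measurable_quarter_cell.
- by exists 1 => z _; rewrite ger0_norm ?k0 ?k1.
- by move=> z _; exact: k0.
- by move=> z _; exact: kern_skew.
Qed.

Theorem theorem17 (R : realType) (V : finType) (C : {set V * V}) :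
  cycle_orientation C -> ~~ odd #|C| ->
  alpha2 C != 0 -> gamma C != 0 -> Num.sg (alpha2 C) != Num.sg (gamma C) ->
  ~ quasirandom_forcing R C.
Proof.
move=> [l [f [orient [l2 fB CE]]]] evC alpha0 gamma0 sg_neq.
have {}CE : C = arcs f orient := CE; subst C.
have fI := bij_inj fB.
have [n ln] : exists n, l = n.*2.
  by exists l./2; rewrite -[LHS]odd_double_half -{1}(card_arcs orient l2 fI) (negbTE evC).
subst l.
have cC : #|arcs f orient| = n.*2 := card_arcs orient l2 fI.
have cV : #|V| = n.*2 by rewrite -(bij_eq_card fB) card_ord.
have := sg_neq_mul_lt0 alpha0 gamma0 sg_neq.
have gE : (gamma (arcs f orient))%:~R = orientation_sign R orient :> R.
  exact: gamma_orientation_sign.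
rewrite -(ltrz0 R) intrM gE.
set alpha : R := (alpha2 _)%:~R; set s := orientation_sign R orient => alpha_s.
have ss : s * s = 1 := orientation_sign_sq R orient.
have ns : `|s| = 1.
  by have /eqP := ss; rewrite -expr2 sqrf_eq1 => /orP[]/eqP ->; rewrite ?normrN normr1.
have S0 := orientation_sign_sum_gt0 R l2 orient fB.
set N : R := #|{ffun V -> bool * bool}|%:R.
have NE : N = 4 ^+ n.*2 by rewrite /N card_ffun card_prod card_bool cV natrX.
set S := _ * _ in S0.
have SE : col_sum (vudiff R) (arcs f orient) = s * S by rewrite /S mulrA ss mul1r.
have [B [B0 expand]] := col_sum_expand R orient l2 fI.
(* [c] is the coefficient of a^2 in the expansion; [d] is positive because [alpha] and [s] have
   opposite signs. *)
pose c : R := 2^-1 ^+ (n.*2 - 2) * (N * alpha).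
pose d := - s * c.
have d0 : 0 < d.
  have dE (x y z w : R) : - x * (y * (z * w)) = y * z * - (w * x) by ring.
  rewrite /d /c dE; apply: mulr_gt0; last by rewrite oppr_gt0.
  by rewrite NE; apply: mulr_gt0; apply: exprn_gt0; lra.
have e0 : 0 < S * 8^-1 ^+ n.*2 by apply: mulr_gt0 => //; apply: exprn_gt0; lra.
have [a [a0 a8 aB ae]] := small_param B0 d0 e0.
have a01 : 0 <= a <= 1 by apply/andP; split; lra.
have [r rB aE] := expand a a01.
have sr : `|s * r| <= B by rewrite normrM ns mul1r.
move: sr; rewrite ler_norml => /andP[sr1 sr2].
have asr1 : a * (s * r) <= a * B by rewrite ler_wpM2l // ltW.
have asr2 : - (a * B) <= a * (s * r) by rewrite -mulrN ler_wpM2l // ltW.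
(* The value of b^l that cancels the perturbation: it solves a^2 (c + a r) + t s S = 0, using s^2 =
   1. The bound on a B makes it non-negative. *)
pose t := a ^+ 2 * (d - a * (s * r)) / S.
have t0 : 0 <= t by apply: divr_ge0 (ltW S0); apply: mulr_ge0; [exact: sqr_ge0 | lra].
(* One factor [a] is absorbed by a <= 1, the other by the bound on a (d + B). *)
have te : t <= 8^-1 ^+ n.*2.
  rewrite ler_pdivrMr // [_ * S]mulrC; apply: le_trans ae.
  rewrite expr2 -mulrA ler_pM2l //.
  have aB1 : a * B <= B by rewrite ler_piMl //; lra.
  apply: (@le_trans _ _ (d - a * (s * r))); last by lra.
  by rewrite ler_piMl //; lra.
have n0 : (0 < n.*2)%N by exact: ltn_trans l2.
have [b [b0 b8 bE]] : exists b, [/\ 0 <= b, b <= 8^-1 & b ^+ n.*2 = t].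
  by apply: small_nth_root => //; lra.
have dens : hom_density (arcs f orient)
    (fun x y : R => kern a b (quarter x) (quarter y)) = 2 ^- #|arcs f orient|.
  rewrite (hom_density_step (@measurable_quarter_cell R) (@unif01_quarter_cell R)).
  rewrite -/(col_sum (kern a b) (arcs f orient)) col_sum_split //.
  rewrite aE bE SE cV cC -/N -/alpha -/c.
  have -> : t * (s * S) = - (a ^+ 2 * (c + a * r)).
    rewrite mulrCA /t divfK ?gt_eqF // /d.
    have tE (x y z w v : R) :
        x * (y * (- x * z - w * (x * v))) = - ((x * x) * (y * (z + w * v))).
      by ring.
    by rewrite tE ss mul1r.
  rewrite addrK NE exprVn mulKf // expf_neq0 //.
have tour := kern_tournamenton (ltW a0) b0 a8 b8.
have p0 : 0 < 4^-1 :> R by lra.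
(* On this pair of quarters the kernel equals 1/2 - 2a - 2b, strictly below 1/2 as a > 0 and b >=
   0. *)
move=> /(_ _ tour dens) /(step_kernel_ae (@measurable_quarter_cell R)
  (@unif01_quarter_cell R) p0 (false, false) (true, false)).
by rewrite /kern /vudiff /udiff /usgn /vsgn /= !expr0 !expr1; lra.
Qed.
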